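(* Let $F(q,x)$ be the coefficient of $z^0$ in the formal expansion of $$\prod_{i=0}^{\infty}(1+zq^{i+1})(1+z^{-1}x^{i}),$$ a formal power series in $q$ and $x$. Then for every nonnegative integer $n$, $f(n)$ equals the sum of the coefficients of $q^m x^r$ in $F(q,x)$ over all pairs of nonnegative integers $(m,r)$ with $m+r=n$ and $m\le r$.
   Context: A Frobenius partition is a two-row array $\begin{pmatrix} a_1&a_2&\cdots&a_k\\ b_1&b_2&\cdots&b_k\end{pmatrix}$ of nonnegative integers with $k\ge 0$, $a_1>a_2>\cdots>a_k\ge 0$ and $b_1>b_2>\cdots>b_k\ge 0$; its weight is $k+\sum_{i=1}^k a_i+\sum_{i=1}^k b_i$. The empty array ($k=0$) is the unique Frobenius partition of weight $0$. $f(n)$ is the number of Frobenius partitions of weight $n$ satisfying $k+\sum_{i=1}^{k}a_i\le\sum_{i=1}^{k}b_i$. *)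

(* Defs.v *)
From HB Require Import structures.
From mathcomp Require Import all_boot all_order all_algebra.

Set Implicit Arguments.
Unset Strict Implicit.
Unset Printing Implicit Defensive.

Import GRing.Theory.

Local Open Scope ring_scope.

(* A two-row array is the pair [ab] of its rows, top row first. *)
Definition frobenius_partition (ab : seq nat * seq nat) : bool :=
  [&& size ab.1 == size ab.2, sorted gtn ab.1 & sorted gtn ab.2].

Definition frobenius_weight (ab : seq nat * seq nat) : nat :=
  (size ab.1 + sumn ab.1 + sumn ab.2)%N.

Definition counted (n : nat) (ab : seq nat * seq nat) : bool :=
  [&& frobenius_partition ab, frobenius_weight ab == n
    & (size ab.1 + sumn ab.1 <= sumn ab.2)%N].

Definition array_of (n k : nat) (t : k.-tuple 'I_n.+1 * k.-tuple 'I_n.+1) :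
    seq nat * seq nat :=
  ([seq val i | i <- t.1], [seq val i | i <- t.2]).

(* An array of weight [n] has at most [n] columns and no entry exceeds [n], so
   bounding both by [n] loses nothing: see [frobenius_countE]. *)
Definition frobenius_count (n : nat) : nat :=
  (\sum_(k < n.+1)
    #|[set t : k.-tuple 'I_n.+1 * k.-tuple 'I_n.+1 | counted n (array_of t)]|)%N.

Lemma array_of_inj n k : injective (@array_of n k).
Proof.
move=> [a b] [c d] [/(inj_map val_inj) /val_inj /= -> ].
by move/(inj_map val_inj) /val_inj ->.
Qed.

Lemma leq_sumn (s : seq nat) x : x \in s -> (x <= sumn s)%N.
Proof.
elim: s => //= y s IH; rewrite inE => /orP[/eqP->|/IH h]; first exact: leq_addr.
exact: leq_trans h (leq_addl _ _).
Qed.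

Lemma bounded_tuple n (s : seq nat) : (forall x, x \in s -> (x <= n)%N) ->
  exists t : (size s).-tuple 'I_n.+1, [seq val i | i <- t] = s.
Proof.
move=> h; have e : [seq val i | i <- [seq inord x : 'I_n.+1 | x <- s]] = s.
  rewrite -map_comp -[RHS]map_id; apply/eq_in_map => x /h xn /=.
  by rewrite inordK.
have sz : size [seq inord x : 'I_n.+1 | x <- s] == size s by rewrite size_map.
by exists (Tuple sz).
Qed.

Lemma frobenius_countE (n : nat) (s : seq (seq nat * seq nat)) :
  uniq s -> s =i counted n -> size s = frobenius_count n.
Proof.
move=> us sE.
pose A k := [set t : k.-tuple 'I_n.+1 * k.-tuple 'I_n.+1 | counted n (array_of t)].
pose l k := [seq array_of t | t <- enum (A k)].
have lE k ab : (ab \in l k) = counted n ab && (size ab.1 == k).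
  apply/mapP/andP => [[t]|[cab /eqP szk]].
    by rewrite mem_enum inE => ct ->; split=> //; rewrite size_map size_tuple.
  case: ab cab szk => a b /= cab szk; subst k.
  have /and3P[/and3P[/eqP/= szab _ _] /eqP w _] := cab.
  rewrite /frobenius_weight /= in w.
  have [ta Ea] : exists t : (size a).-tuple 'I_n.+1, [seq val i | i <- t] = a.
    apply: bounded_tuple => x /leq_sumn h; apply: leq_trans h _.
    by rewrite -w -addnA addnCA leq_addr.
  have [tb Eb] : exists t : (size a).-tuple 'I_n.+1, [seq val i | i <- t] = b.
    rewrite szab; apply: bounded_tuple => x /leq_sumn h; apply: leq_trans h _.
    by rewrite -w leq_addl.
  have E : array_of (ta, tb) = (a, b) by rewrite /array_of Ea Eb.
  by exists (ta, tb); rewrite ?E // mem_enum inE E.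
have szle ab : counted n ab -> (size ab.1 <= n)%N.
  case/and3P=> _ /eqP <- _; rewrite /frobenius_weight -addnA; exact: leq_addr.
rewrite /frobenius_count.
transitivity (\sum_(k < n.+1) count (fun ab => size ab.1 == k) s)%N.
  transitivity (\sum_(ab <- s) \sum_(k < n.+1) (size ab.1 == k))%N; last first.
    rewrite exchange_big /=; apply: eq_bigr => k _.
    by rewrite -sum1_count [RHS]big_mkcond; apply: eq_bigr => ab _; case: (_ == _).
  rewrite -sum1_size; apply: eq_big_seq => ab; rewrite sE => /szle h.
  rewrite (bigD1 (Ordinal (h : size ab.1 < n.+1)%N)) //= eqxx big1 // => i.
  by rewrite -val_eqE /= eq_sym => /negbTE->.
apply: eq_bigr => k _; rewrite -size_filter cardE -(size_map (@array_of n k)).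
apply/perm_size/uniq_perm; first exact: filter_uniq.
  by rewrite map_inj_uniq ?enum_uniq //; apply: array_of_inj.
by move=> ab; rewrite mem_filter sE lE andbC.
Qed.

(* Polynomials in q and x: [(c`_m)`_r] is the coefficient of q^m x^r in [c]. *)
Notation polyqx := {poly {poly int}}.

(* Laurent polynomials in z over [polyqx] are viewed in the fraction field of
   [{poly polyqx}], where z has an inverse. *)
Notation fracz := {fraction {poly polyqx}}.

Definition zvar : fracz := tofrac 'X.
Definition qvar : fracz := tofrac ('X)%:P.
Definition xvar : fracz := tofrac (('X)%:P)%:P.

Definition partial_product (N : nat) : fracz :=
  \prod_(i < N) ((1 + zvar * qvar ^+ i.+1) * (1 + zvar^-1 * xvar ^+ i)).

(* [c] is the coefficient of z^a in the Laurent polynomial [L] = p / z^d. *)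
Definition is_coefz (L : fracz) (a : int) (c : polyqx) : Prop :=
  exists (p : {poly polyqx}) (d j : nat),
    [/\ L = tofrac p / zvar ^+ d, j%:Z = a + d%:Z & c = p`_j].

Lemma is_coefz_unique (L : fracz) (a : int) (c c' : polyqx) :
  is_coefz L a c -> is_coefz L a c' -> c = c'.
Proof.
move=> [p [d [j [-> ja ->]]]] [p' [d' [j' [e ja' ->]]]].
have z0 : zvar != 0 by rewrite /zvar tofrac_eq0 polyX_eq0.
have E : p * 'X^d' = p' * 'X^d.
  apply/eqP; rewrite -tofrac_eq; apply/eqP; rewrite !tofracM !tofracXn -/zvar.
  have := congr1 (fun y => y * zvar ^+ d * zvar ^+ d') e.
  by rewrite divfK ?expf_neq0 // mulrAC divfK ?expf_neq0.
have jd : (j + d' = j' + d)%N.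
  by apply/eqP; rewrite -eqz_nat !PoszD ja ja' addrAC.
have := congr1 (fun y : {poly polyqx} => y`_(j + d')) E.
by rewrite {2}jd !coefMXn !ltnNge !leq_addl /= !addnK.
Qed.

(* [G a m r] is the coefficient of z^a q^m x^r in the infinite product: each
   coefficient of the partial products is eventually constant, equal to it. *)
Definition is_expansion (G : int -> nat -> nat -> int) : Prop :=
  forall (a : int) (m r : nat), exists N0 : nat, forall N : nat, (N0 <= N)%N ->
    exists2 c : polyqx, is_coefz (partial_product N) a c & (c`_m)`_r = G a m r.

(* Main.v *)
Require Import Defs.
From HB Require Import structures.
From mathcomp Require Import all_boot all_order all_algebra.
From mathcomp Require Import zify.

Set Implicit Arguments.
Unset Strict Implicit.
Unset Printing Implicit Defensive.

Import GRing.Theory.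

Local Open Scope ring_scope.

(* Choosing a summand in each of the factors [1 + z q^(i+1)] and
    [1 + z^-1 x^i], [i < N], amounts to choosing the strictly decreasing
    sequences [s] and [t] of the indices [i] where the second summand is taken;
    the choice contributes z^(|s|-|t|) q^(|s| + sum s) x^(sum t).  So the
    coefficient of z^a q^m x^r counts pairs [(s, t)], and it is stable in [N]
    because only indices at most [max m r] can occur.  For [a = 0] the pairs
    are the Frobenius partitions with m = k + sum a_i and r = sum b_i. *)

(** The recursion decides whether the largest index [N'] is taken, which mirrors peeling the last
    factor off a product over [i < N]. *)
Fixpoint strict_rows (N : nat) : seq (seq nat) :=
  if N is N'.+1 then strict_rows N' ++ [seq N' :: s | s <- strict_rows N']
  else [:: [::]].

Lemma mem_strict_rows N s :
  (s \in strict_rows N) = sorted gtn s && all (gtn N) s.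
Proof.
elim: N s => [|N IH] s; first by case: s => //= x s; rewrite andbF.
rewrite /= mem_cat IH; case: s => [|x s] //=.
have gtn_trans : transitive gtn by move=> ? ? ? /= h h'; apply: ltn_trans h' h.
have -> : (x :: s \in [seq N :: s0 | s0 <- strict_rows N]) =
          (x == N) && (s \in strict_rows N).
  by apply/mapP/andP => [[s0 ? [-> ->]]|[/eqP-> ?]]; [rewrite eqxx | exists s].
rewrite IH (path_sortedE gtn_trans) ltnS.
have mono k : (k <= N)%N -> all (gtn k) s -> all (gtn N) s.
  by move=> kN; apply: sub_all => y /= yk; apply: leq_trans yk kN.
have monoS : all (gtn N) s -> all (gtn N.+1) s.
  by apply: sub_all => y /= /ltnW.
case: (sorted gtn s); rewrite ?(andbF, andbT) //=.
(* The head is the largest entry: [x < N] falls in the first half of the list, [x = N] in the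
   second, and [x > N] in neither. *)
case: (ltngtP x N) => [xN|xN|->] /=.
- rewrite orbF; case: (boolP (all (gtn x) s)) => //= h.
  by have h' := mono _ (ltnW xN) h; rewrite h' (monoS h').
- by rewrite andbF.
- by rewrite andbF /=; case: (boolP (all (gtn N) s)) => //= /monoS.
Qed.

Lemma uniq_strict_rows N : uniq (strict_rows N).
Proof.
elim: N => //= N IH; rewrite cat_uniq IH map_inj_uniq ?IH; last by move=> ? ? [].
rewrite andbT /=; apply/hasPn => _ /mapP[s _ ->].
by rewrite mem_strict_rows /= ltnn andbF.
Qed.

Lemma size_strict_rows N s : s \in strict_rows N -> (size s <= N)%N.
Proof.
elim: N s => [|N IH] s /=; first by rewrite inE => /eqP->.
by rewrite mem_cat => /orP[/IH/leqW|/mapP[t /IH h ->]].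
Qed.

(** The first summand [g] is left general: it is 1 in the factors carrying q, and z in those
    carrying x once z^-1 has been cleared. *)
Lemma prod_strict_rows (R : comNzRingType) (g : R) (f : nat -> R) N :
  \prod_(i < N) (g + f i) =
  \sum_(s <- strict_rows N) g ^+ (N - size s) * \prod_(i <- s) f i.
Proof.
elim: N => [|N IH]; first by rewrite big_ord0 big_seq1 big_nil mulr1.
rewrite big_ord_recr /= IH big_cat big_map mulrDr !mulr_suml.
congr (_ + _); last by apply: eq_bigr => s _; rewrite /= subSS big_cons mulrAC mulrA.
apply: eq_big_seq => s /size_strict_rows sN.
by rewrite subSn // exprSr mulrAC.
Qed.

Definition row_pairs N : seq (seq nat * seq nat) :=
  [seq (s, t) | s <- strict_rows N, t <- strict_rows N].

Lemma mem_row_pairs N ab :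
  (ab \in row_pairs N) =
  (ab.1 \in strict_rows N) && (ab.2 \in strict_rows N).
Proof.
case: ab => a b; apply/allpairsP/andP => [[[c d] /= [? ? [-> ->]]]|[? ?]] //.
by exists (a, b).
Qed.

Lemma uniq_row_pairs N : uniq (row_pairs N).
Proof. by apply: allpairs_uniq; rewrite ?uniq_strict_rows // => -[? ?] []. Qed.

Definition pair_type (a : int) (m r : nat) (ab : seq nat * seq nat) : bool :=
  [&& (size ab.1)%:Z == a + (size ab.2)%:Z,
      (size ab.1 + sumn ab.1 == m)%N & (sumn ab.2 == r)%N].

(** An entry is at most the sum of its row, hence at most [m] or [r], so raising the bound beyond
    [M] brings in no new pair. *)
Lemma count_row_pairs a m r M N : (m < M)%N -> (r < M)%N -> (M <= N)%N ->
  count (pair_type a m r) (row_pairs N) = count (pair_type a m r) (row_pairs M).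
Proof.
move=> mM rM MN; rewrite -!size_filter; apply/perm_size/uniq_perm;
  rewrite ?filter_uniq ?uniq_row_pairs // => -[s t].
rewrite !mem_filter !mem_row_pairs !mem_strict_rows /=.
case: (boolP (pair_type _ _ _ _)) => //= /and3P[/= _ /eqP sm /eqP tr].
have bounded u K : (M <= K)%N -> (sumn u < M)%N -> all (gtn K) u.
  move=> MK uM; apply/allP => y /leq_sumn yu /=.
  exact: leq_ltn_trans yu (leq_trans uM MK).
by rewrite !bounded //; lia.
Qed.

(** This is z^N times the partial product, one z going to each factor 1 + z^-1 x^i, so that it is a
    polynomial in z. The outermost ['X] is z; under one [%:P] it is q, under two it is x. *)
Definition cleared_product N : {poly polyqx} :=
  \prod_(i < N) (1 + 'X * ('X ^+ i.+1)%:P) * \prod_(i < N) ('X + (('X ^+ i)%:P)%:P).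

Lemma partial_productE N :
  partial_product N = tofrac (cleared_product N) / zvar ^+ N.
Proof.
have z0 : zvar != 0 by rewrite /zvar tofrac_eq0 polyX_eq0.
rewrite /partial_product /cleared_product big_split /= tofracM -mulrA; congr (_ * _).
  rewrite rmorph_prod; apply: eq_bigr => i _.
  by rewrite /= tofracD tofrac1 tofracM rmorphXn /= tofracXn.
have -> : zvar ^+ N = \prod_(i < N) zvar by rewrite prodr_const card_ord.
rewrite rmorph_prod -prodf_div; apply: eq_bigr => i _.
by rewrite /= tofracD mulrDl divff // mulrC !rmorphXn.
Qed.

Lemma cleared_productE N :
  cleared_product N = \sum_(ab <- row_pairs N)
    'X^(N - size ab.2 + size ab.1) *
      ('X^(size ab.1 + sumn ab.1) * ('X^(sumn ab.2))%:P)%:P.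
Proof.
rewrite /cleared_product
  (prod_strict_rows 1 (fun i => 'X * ('X ^+ i.+1)%:P))
  (prod_strict_rows 'X (fun i => (('X ^+ i)%:P)%:P)).
rewrite big_distrlr /= big_allpairs; apply: eq_bigr => s _; apply: eq_bigr => t _.
have -> : \prod_(i <- s) ('X * ('X ^+ i.+1)%:P) =
          'X^(size s) * ('X^(size s + sumn s))%:P :> {poly polyqx}.
  elim: s => [|y s IH]; first by rewrite big_nil mulr1.
  rewrite big_cons IH /= mulrACA -exprS -polyCM -exprD.
  by congr (_ * ('X^_)%:P); lia.
have -> : \prod_(i <- t) (('X ^+ i)%:P)%:P = (('X^(sumn t))%:P)%:P :> {poly polyqx}.
  elim: t => [|y t IH]; first by rewrite big_nil.
  by rewrite big_cons IH /= -!polyCM -exprD.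
by rewrite expr1n mul1r mulrACA -exprD [(size s + _)%N in LHS]addnC polyCM.
Qed.

Lemma coef_cleared_product N a m r j : j%:Z = a + N%:Z ->
  (((cleared_product N)`_j)`_m)`_r =
  (count (pair_type a m r) (row_pairs N))%:Z.
Proof.
move=> ja; rewrite cleared_productE !coef_sum -sum1_count -natz natr_sum.
rewrite [RHS]big_mkcond; apply: eq_big_seq => -[s t].
rewrite mem_row_pairs /= => /andP[_ /size_strict_rows tN].
rewrite !(coefMC, coefXn, mulr_natl, coefMn, natz).
(* The bound [tN] makes the truncated subtraction exact; the shift by [N] in [j] undoes the
   clearing. *)
have -> : (j == N - size t + size s)%N = ((size s)%:Z == a + (size t)%:Z) by lia.
rewrite /pair_type /= ![(_ == m)%N]eq_sym ![(_ == r)%N]eq_sym.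
by do 3! case: (_ == _).
Qed.

Lemma is_coefz_partial_product N a m r M :
  (m < M)%N -> (r < M)%N -> (M + `|a| <= N)%N ->
  exists2 c, is_coefz (partial_product N) a c &
    (c`_m)`_r = (count (pair_type a m r) (row_pairs M))%:Z.
Proof.
(* The summand [|a|] in the bound on [N] ensures that the shifted exponent a + N is nonnegative even
   when [a] is negative. *)
move=> mM rM MN; have ja : (absz (a + N%:Z))%:Z = a + N%:Z by lia.
exists (cleared_product N)`_(absz (a + N%:Z)).
  by exists (cleared_product N), N, (absz (a + N%:Z)); split; rewrite ?partial_productE.
rewrite (coef_cleared_product _ _ ja) (count_row_pairs _ mM rM) //.
exact: leq_trans (leq_addr _ _) MN.
Qed.

Lemma frobenius_count_row_pairs n :
  frobenius_count n = count (counted n) (row_pairs n.+1).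
Proof.
rewrite -size_filter; apply/esym/frobenius_countE.
  by rewrite filter_uniq ?uniq_row_pairs.
move=> [s t]; rewrite mem_filter mem_row_pairs !mem_strict_rows.
rewrite -[in RHS]topredE /=; apply/andb_idr => /and3P[/and3P[_ /= -> ->] /eqP w _].
rewrite /frobenius_weight /= in w.
by apply/andP; split; apply/allP => y /leq_sumn /=; lia.
Qed.

(** Double counting: exchanging the sums reduces the claim to one array, which has type (0, m, r)
    for at most one index (m, r). Sortedness is assumed because [pair_type] does not record it. *)
Lemma count_counted n (u : seq (seq nat * seq nat)) :
  {in u, forall ab, sorted gtn ab.1 && sorted gtn ab.2} ->
  count (counted n) u =
  (\sum_(mr : 'I_n.+1 * 'I_n.+1 | (mr.1 + mr.2 == n) && (mr.1 <= mr.2))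
     count (pair_type 0 mr.1 mr.2) u)%N.
Proof.
move=> u_sorted; rewrite -sum1_count big_mkcond /=.
under [RHS]eq_bigr do rewrite -sum1_count big_mkcond /=.
rewrite exchange_big; apply: eq_big_seq => -[s t] /u_sorted /= st.
rewrite /counted /frobenius_partition /frobenius_weight /= st andbT.
set m := (size s + sumn s)%N.
rewrite -big_mkcondr /= sum1_card.
case: ifP => [/and3P[/eqP sz /eqP mr le]|ne].
  have mn : (m < n.+1)%N by lia.
  have tn : (sumn t < n.+1)%N by lia.
  (* The only index matching a counted array is (k + sum a_i, sum b_i), both components being at
     most [n]. *)
  rewrite (@eq_card1 _ (Ordinal mn, Ordinal tn)) // => -[i j].
  rewrite unfold_in inE /pair_type /= add0r -sz eqxx /= -/m xpair_eqE -!val_eqE /=.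
  by apply/idP/idP; lia.
apply/esym; apply: eq_card0 => -[i j]; rewrite unfold_in /= /pair_type /= add0r -/m.
by apply/negP => h; move/negP: ne; apply; lia.
Qed.

Theorem mainTheorem2 :
  (exists G : int -> nat -> nat -> int, is_expansion G) /\
  (forall G : int -> nat -> nat -> int, is_expansion G ->
   let F : nat -> nat -> int := G 0 in
   forall n : nat,
     (frobenius_count n)%:Z =
     \sum_(mr : 'I_n.+1 * 'I_n.+1 | (mr.1 + mr.2 == n)%N && (mr.1 <= mr.2)%N)
        F mr.1 mr.2).
Proof.
split.
  exists (fun a m r => (count (pair_type a m r) (row_pairs (m + r).+1))%:Z).
  move=> a m r; exists ((m + r).+1 + `|a|)%N => N.
  by apply: is_coefz_partial_product; rewrite ltnS ?leq_addr ?leq_addl.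
move=> G expG F n; rewrite frobenius_count_row_pairs count_counted; last first.
  move=> ab; rewrite mem_row_pairs !mem_strict_rows.
  by case/andP=> /andP[-> _] /andP[-> _].
rewrite -natz natr_sum; apply: eq_bigr => -[m r] _ /=.
have [N0 GN] := expG 0 m r.
(* This partial product is past the threshold [N0] of [G] and also long enough for the count with
   rows bounded by [n.+1]; uniqueness of z-coefficients then identifies the two values. *)
have [c cz Gc] := GN (n.+1 + N0)%N (leq_addl _ _).
have := @is_coefz_partial_product (n.+1 + N0) 0 m r n.+1 (ltn_ord m) (ltn_ord r).
rewrite addn0 leq_addr => /(_ isT)[c' c'z c'E].
by rewrite natz -c'E -(is_coefz_unique cz c'z) Gc.
Qed.
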